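(* Let $\mathbf{Y}$ be a $d$-variate Hüsler--Reiss random vector with variogram matrix $\Gamma\in\mathcal{C}^d$, and let $A,B,C\subset[d]$ be pairwise disjoint with $C\neq\emptyset$. Then $\mathbf{Y}_A$ and $\mathbf{Y}_B$ are extremal conditionally independent given $\mathbf{Y}_C$ if and only if $$\operatorname{rank}\big(\operatorname{CM}(\Gamma_{A\cup C,\,B\cup C})\big)=\#C+1 .$$
   Context: $[d]=\{1,\dots,d\}$. $\mathcal{C}^d$ is the set of strictly conditionally negative definite matrices: real symmetric $d\times d$ matrices $\Gamma$ with zero diagonal such that $v^\top\Gamma v<0$ for all $v\ne\mathbf{0}$ with $v\perp\mathbf{1}$. For index sets $I,J\subseteq[d]$, $\Gamma_{I,J}$ is the submatrix of $\Gamma$ with rows $I$ and columns $J$, and $$\operatorname{CM}(\Gamma_{I,J})=\begin{pmatrix}-\tfrac12\Gamma_{I,J}&\mathbf{1}\\ \mathbf{1}^\top&0\end{pmatrix}$$ (a $(\#I+1)\times(\#J+1)$ matrix); $\operatorname{CM}(\Gamma)$ is the case $I=J=[d]$, and it is invertible for $\Gamma\in\mathcal{C}^d$. A Hüsler--Reiss random vector $\mathbf{Y}$ with variogram $\Gamma\in\mathcal{C}^d$ is the random vector supported on $\mathcal{L}=\{\mathbf{y}\in\mathbb{R}^d:\mathbf{y}\not\le\mathbf{0}\}$ (at least one coordinate positive) whose density is proportional to the exponent measure density $$\lambda(\mathbf{y})=c_1\exp\Big(-\tfrac12\begin{pmatrix}\mathbf{y}^\top&1\end{pmatrix}\operatorname{CM}(\Gamma)^{-1}\begin{pmatrix}\mathbf{y}\\1\end{pmatrix}\Big),\qquad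 c_1=\frac{1}{\sqrt{-\det(\operatorname{CM}(2\pi\Gamma))}} ,\qquad \mathbf{y}\in\mathbb{R}^d .$$ For nonempty $D\subseteq[d]$ let $\lambda_D(\mathbf{y}_D)=\int_{\mathbb{R}^{d-\#D}}\lambda(\mathbf{y})\,d\mathbf{y}_{[d]\setminus D}$ be the marginal exponent measure density; $\lambda_{AC}$ means $\lambda_{A\cup C}$, etc. For pairwise disjoint $A,B,C\subset[d]$, $\mathbf{Y}_A$ is extremal conditionally independent of $\mathbf{Y}_B$ given $\mathbf{Y}_C$ (written $\mathbf{Y}_A\perp_e\mathbf{Y}_B\mid\mathbf{Y}_C$) if $$\lambda_{ABC}(\mathbf{y}_{ABC})\,\lambda_C(\mathbf{y}_C)=\lambda_{AC}(\mathbf{y}_{AC})\,\lambda_{BC}(\mathbf{y}_{BC})\quad\text{for all }\mathbf{y}\in\mathcal{L}.$$ *)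

(* Defs.v *)
From HB Require Import structures.
From mathcomp Require Import all_boot all_order all_algebra.
From mathcomp Require Import all_classical all_reals all_analysis.
From mathcomp Require Import measurable_realfun.
Import Order.TTheory GRing.Theory Num.Theory numFieldNormedType.Exports.

Set Implicit Arguments.
Unset Strict Implicit.
Unset Printing Implicit Defensive.

Local Open Scope classical_set_scope.
Local Open Scope ring_scope.

Section LebesgueTuple.
Context {R : realType}.
Local Notation vec n := (n.-tuple (measurableTypeR R)).

Definition tcons n (p : measurableTypeR R * vec n) : vec n.+1 :=
  [tuple of p.1 :: p.2].

Definition tuncons n (t : vec n.+1) : measurableTypeR R * vec n :=
  (thead t, [tuple of behead t]).

Lemma tconsK n : cancel (@tcons n) (@tuncons n).
Proof. by case=> x t; congr pair; apply: val_inj. Qed.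

Lemma tunconsK n : cancel (@tuncons n) (@tcons n).
Proof. by move=> t; rewrite [RHS]tuple_eta; apply: val_inj. Qed.

Lemma measurable_tcons n : measurable_fun setT (@tcons n).
Proof. exact: measurable_cons. Qed.

Lemma measurable_tuncons n : measurable_fun setT (@tuncons n).
Proof.
apply: measurable_fun_pair; last exact: measurable_behead.
exact: measurable_tnth.
Qed.

Section Step.
Variables (n : nat) (mu : {sigma_finite_measure set (vec n) -> \bar R}).

Definition lebesgue_tupleS : set (vec n.+1) -> \bar R :=
  pushforward (@lebesgue_measure R \x mu)%E (@tcons n).

Let tupleS0 : lebesgue_tupleS set0 = 0%E.
Proof. by rewrite /lebesgue_tupleS /pushforward preimage_set0 measure0. Qed.

Let tupleS_ge0 A : (0 <= lebesgue_tupleS A)%E.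
Proof. by rewrite /lebesgue_tupleS /pushforward measure_ge0. Qed.

Let tupleS_sigma_additive : semi_sigma_additive lebesgue_tupleS.
Proof.
move=> F mF tF mUF; have mpre A : measurable A -> measurable (@tcons n @^-1` A).
  by move=> mA; rewrite -[X in measurable X]setTI; exact: measurable_tcons.
rewrite /lebesgue_tupleS /pushforward preimage_bigcup.
apply: measure_semi_sigma_additive => [i||]; first exact: mpre.
- apply/trivIsetP => i j _ _ ij; rewrite -preimage_setI.
  by move/trivIsetP : tF => /(_ _ _ _ _ ij) ->//; rewrite preimage_set0.
- by rewrite -preimage_bigcup; exact: mpre.
Qed.

HB.instance Definition _ := isMeasure.Build _ _ _ lebesgue_tupleS
  tupleS0 tupleS_ge0 tupleS_sigma_additive.

Lemma sigma_finite_lebesgue_tupleS : sigma_finite setT lebesgue_tupleS.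
Proof.
have /sigma_finiteP[F [TF ndF Foo]] := sigma_finiteT (@lebesgue_measure R).
have /sigma_finiteP[G [TG ndG Goo]] := sigma_finiteT mu.
exists (fun k => @tuncons n @^-1` (F k `*` G k)) => [|k].
  rewrite -preimage_bigcup (_ : \bigcup_i _ = setT) ?preimage_setT//.
  apply/seteqP; split=> // -[x y] _.
  have [i _ Fix] : (\bigcup_i F i) x by rewrite -TF.
  have [j _ Gjy] : (\bigcup_i G i) y by rewrite -TG.
  exists (maxn i j) => //; split => /=.
  - by move: x Fix; exact/subsetPset/ndF/leq_maxl.
  - by move: y Gjy; exact/subsetPset/ndG/leq_maxr.
have [[mF Fk] [mG Gk]] := (Foo k, Goo k); split.
  rewrite -[X in measurable X]setTI; apply: measurable_tuncons => //.
  exact: measurableX.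
rewrite /lebesgue_tupleS /pushforward (_ : _ @^-1` _ = F k `*` G k).
  by rewrite product_measure1E// lte_mul_pinfty// ge0_fin_numE.
by rewrite -comp_preimage (_ : _ \o _ = id)//; apply/funext => p /=; rewrite tconsK.
Qed.

HB.instance Definition _ := @Measure_isSigmaFinite.Build _ _ _
  lebesgue_tupleS sigma_finite_lebesgue_tupleS.

End Step.

(* Lebesgue measure on R^n: the n-fold product of the Lebesgue measure on R,
   transported to n-tuples; for n = 0 the unit mass at the empty tuple. *)
Fixpoint lebesgue_tuple n : {sigma_finite_measure set (vec n) -> \bar R} :=
  match n with
  | 0 => \d_([tuple] : vec 0)
  | m.+1 => lebesgue_tupleS (lebesgue_tuple m)
  end.

End LebesgueTuple.

Section Variogram.
Context {R : realType}.

Definition strictly_cnd d (Gamma : 'M[R]_d) : Prop :=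
  [/\ Gamma^T = Gamma,
      forall i, Gamma i i = 0 &
      forall v : 'cV[R]_d, v != 0 -> \sum_i v i 0 = 0 ->
        (v^T *m Gamma *m v) 0 0 < 0].

(* The submatrix with rows [I] and columns [J], both listed in increasing
   order. *)
Definition set_submx m n (I : {set 'I_m}) (J : {set 'I_n}) (M : 'M[R]_(m, n)) :
    'M[R]_(#|I|, #|J|) :=
  mxsub (@enum_val _ (mem I)) (@enum_val _ (mem J)) M.

Definition CM m n (M : 'M[R]_(m, n)) : 'M[R]_(m + 1, n + 1) :=
  block_mx (- 2^-1 *: M) (const_mx 1) (const_mx 1) 0.

End Variogram.

Section ExtremalConditionalIndependence.
Context {R : realType}.
Local Notation vec n := (n.-tuple (measurableTypeR R)).

Definition not_le0 n : set (vec n) :=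
  [set y | exists i, 0 < tnth y i].

(* A random vector together with an exponent measure density lambda on R^n:
   its law is lambda restricted to [not_le0 n], normalized by k. The density is
   part of the data because extremal conditional independence is a property of
   lambda on the whole of R^n, not only on [not_le0 n]. *)
Record exponent_vector disp (T : measurableType disp) (P : probability T R)
    (n : nat) := ExponentVector {
  rvector :> {RV P >-> vec n};
  exponent_density : vec n -> R;
  exponent_density_ge0 : forall y, 0 <= exponent_density y;
  measurable_exponent_density : measurable_fun setT exponent_density;
  exponent_law : exists2 k : R, 0 < k &
    forall S : set (vec n), measurable S ->
      distribution P rvector S =
      (k%:E * \int[lebesgue_tuple n]_(y in S `&` @not_le0 n)
                (exponent_density y)%:E)%E }.

Definition restrict n (D : {set 'I_n}) (y : vec n) : vec #|D| :=
  [tuple tnth y (enum_val i) | i < #|D|].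

(* The point of R^n with coordinates [u] on [D] and [z] on the complement of
   [D]. *)
Definition glue n (D : {set 'I_n}) (u : vec #|D|) (z : vec #|~: D|) :
    vec n :=
  [tuple if i \in D then nth 0 u (index i (enum D))
         else nth 0 z (index i (enum (~: D))) | i < n].

Definition marginal n (lambda : vec n -> R) (D : {set 'I_n})
    (u : vec #|D|) : \bar R :=
  (\int[lebesgue_tuple #|~: D|]_z (lambda (glue u z))%:E)%E.

Definition ext_cond_indep disp (T : measurableType disp) (P : probability T R)
    n (Y : exponent_vector P n) (A B C : {set 'I_n}) : Prop :=
  let lambda_ D y := marginal (exponent_density Y) (restrict D y) in
  forall y, @not_le0 n y ->
    (lambda_ (A :|: B :|: C) y * lambda_ C y =
     lambda_ (A :|: C) y * lambda_ (B :|: C) y)%E.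

End ExtremalConditionalIndependence.

Section HueslerReiss.
Context {R : realType}.
Local Notation vec n := (n.-tuple (measurableTypeR R)).

Definition hr_density n (Gamma : 'M[R]_n) (y : vec n) : R :=
  let y1 : 'cV[R]_(n + 1) := col_mx (\col_i tnth y i) 1%:M in
  (Num.sqrt (- \det (CM ((2 * pi) *: Gamma))))^-1 *
  expR (- 2^-1 * (y1^T *m invmx (CM Gamma) *m y1) 0 0).

Definition husler_reiss disp (T : measurableType disp) (P : probability T R)
    n (Gamma : 'M[R]_n) (Y : exponent_vector P n) : Prop :=
  forall y, exponent_density Y y = hr_density Gamma y.

End HueslerReiss.

(* Main.v *)
Require Import Defs.
From mathcomp Require Import all_boot all_order all_algebra perm.
From mathcomp Require Import all_classical all_reals all_analysis.
From mathcomp Require Import measurable_realfun ring zify.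
Import Order.TTheory GRing.Theory Num.Theory numFieldNormedType.Exports.

Set Implicit Arguments.
Unset Strict Implicit.
Unset Printing Implicit Defensive.

Local Open Scope ring_scope.

(** Write M for CM(Gamma) and M_D for CM(Gamma_(D, D)), which is the block of M
    at D and the bordering index.  Let S be the Schur complement of the block
    M_C in M.

    Everything about the marginal densities is Gaussian algebra in terms of M.
    On the vectors (y, 1) the exponent is the quadratic form of the inverse of
    M.  Completing the square splits it into the form of the inverse of M_D on
    (y_D, 1) and the form of the inverse of the Schur complement of M_D on the
    residuals of the remaining coordinates ([qform_join]).  The second form is
    positive definite because Gamma is conditionally negative definite
    ([posdef_inv_schur]), so the Gaussian integral over the remaining
    coordinates ([integral_gauss]) shows that lambda_D is again the exponential
    of the quadratic form of the inverse of M_D, with a constant that depends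
    on D only through #D and the determinant of M_D ([marginal_hr]).

    The same splitting is now applied to D = A u B u C, A u C and B u C, each
    time relative to C ([marginal_part]).  The terms in y_C cancel from the
    equation lambda_ABC lambda_C = lambda_AC lambda_BC, and what remains
    compares the Gaussian with covariance S_(AB, AB), at the residuals of
    (y_A, y_B) given y_C, with the product of those with covariances S_(A, A)
    and S_(B, B).  As y runs over the points that equal 1 on the nonempty set C
    the residuals take every value ([resid_surj]), so the equation for all y
    amounts to S_(A, B) = 0 ([ci_iff_cross_schur0]).  The rank of a matrix with
    an invertible block is the size of this block plus the rank of its Schur
    complement, so the rank of CM(Gamma_(A u C, B u C)) is
    #C + 1 + rank S_(A, B) ([rank_iff_cross_schur0]), and the rank condition is
    S_(A, B) = 0 as well.

    Submatrices are taken along maps of ordinals that list the chosen indices.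
    Blocks come from concatenated lists ([join_idx]), and two lists of the same
    set of indices give the same determinant, rank and quadratic form. *)

(** * Submatrices along lists of indices *)

Section Reindexing.
Variable F : fieldType.

Definition join_idx T p q (f : 'I_p -> T) (g : 'I_q -> T)
    (i : 'I_(p + q)) : T :=
  match fintype.split i with inl j => f j | inr j => g j end.

Lemma join_idxl T p q (f : 'I_p -> T) (g : 'I_q -> T) j :
  join_idx f g (lshift q j) = f j.
Proof. by rewrite /join_idx (unsplitK (inl _ j)). Qed.

Lemma join_idxr T p q (f : 'I_p -> T) (g : 'I_q -> T) j :
  join_idx f g (rshift p j) = g j.
Proof. by rewrite /join_idx (unsplitK (inr _ j)). Qed.

Lemma join_idx_inj (T : eqType) p q (f : 'I_p -> T) (g : 'I_q -> T) :
  injective f -> injective g -> (forall i j, f i != g j) ->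
  injective (join_idx f g).
Proof.
move=> fI gI fg i j; rewrite -(splitK i) -(splitK j).
case: (fintype.split i) (fintype.split j) => i' [] j' /=;
  rewrite ?join_idxl ?join_idxr => // eq_fg.
- by rewrite (fI _ _ eq_fg).
- by have := fg i' j'; rewrite eq_fg eqxx.
- by have := fg j' i'; rewrite eq_fg eqxx.
- by rewrite (gI _ _ eq_fg).
Qed.

Lemma codom_join_idx (T : finType) p q (f : 'I_p -> T) (g : 'I_q -> T) x :
  (x \in codom (join_idx f g)) = (x \in codom f) || (x \in codom g).
Proof.
apply/codomP/orP => [[i ->]|[] /codomP [i ->]].
- rewrite -(splitK i); case: (fintype.split i) => j /=.
    by rewrite join_idxl; left; apply: codom_f.
  by rewrite join_idxr; right; apply: codom_f.
- by exists (lshift q i); rewrite join_idxl.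
- by exists (rshift p i); rewrite join_idxr.
Qed.

Lemma reindex_same_codom (T : finType) p q (f : 'I_p -> T) (g : 'I_q -> T) :
  injective f -> injective g -> codom f =i codom g ->
  exists2 s : 'I_q -> 'I_p, bijective s & g =1 f \o s.
Proof.
move=> fI gI fg.
have /fin_all_exists[s gs] i : exists j, g i = f j.
  by apply/codomP; rewrite fg codom_f.
have /fin_all_exists[t ft] i : exists j, f i = g j.
  by apply/codomP; rewrite -fg codom_f.
exists s => //; exists t => i; first by apply: gI; rewrite -ft -gs.
by apply: fI; rewrite -gs -ft.
Qed.

Lemma mulmx_mxsub_bij m n p m' n' p' (f : 'I_m' -> 'I_m) (h : 'I_n' -> 'I_n)
    (g : 'I_p' -> 'I_p) (A : 'M[F]_(m, n)) (B : 'M[F]_(n, p)) :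
  bijective h -> mxsub f h A *m mxsub h g B = mxsub f g (A *m B).
Proof.
move=> hB; apply/matrixP => i j; rewrite !mxE (reindex h) /=.
  by apply: eq_bigr => k _; rewrite !mxE.
exact: onW_bij.
Qed.

Lemma invmx_unique n (A B : 'M[F]_n) : A *m B = 1%:M -> invmx A = B.
Proof.
move=> AB; have [uA _] := mulmx1_unit AB.
by rewrite -[LHS]mulmx1 -AB mulKmx.
Qed.

Lemma mxsub_bij_inv m n (h : 'I_m -> 'I_n) (M : 'M[F]_n) : bijective h ->
  M \in unitmx ->
  mxsub h h M \in unitmx /\ invmx (mxsub h h M) = mxsub h h (invmx M).
Proof.
move=> hB uM.
have e : mxsub h h M *m mxsub h h (invmx M) = 1%:M.
  rewrite mulmx_mxsub_bij // mulmxV //; apply/matrixP => i j.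
  by rewrite !mxE (inj_eq (bij_inj hB)).
by split; [case: (mulmx1_unit e) | exact: invmx_unique].
Qed.

Lemma det_mxsub_bij m n (h : 'I_m -> 'I_n) (M : 'M[F]_n) :
  bijective h -> \det (mxsub h h M) = \det M.
Proof.
move=> hB; have mn : m = n by have := bij_eq_card hB; rewrite !card_ord.
subst n; have hI := bij_inj hB.
have -> : mxsub h h M = row_perm (perm hI) (col_perm (perm hI) M).
  by apply/matrixP => i j; rewrite !mxE !permE.
rewrite row_permE col_permE !det_mulmx !det_perm odd_permV mulrCA.
by rewrite -signr_addb addbb mulr1.
Qed.

Lemma mxrank_mxsub m n m' n' (f : 'I_m' -> 'I_m) (g : 'I_n' -> 'I_n)
    (A : 'M[F]_(m, n)) : (\rank (mxsub f g A) <= \rank A)%N.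
Proof.
have -> : mxsub f g A = rowsub f 1%:M *m A *m colsub g 1%:M.
  by rewrite -mulmxA mulmx_colsub mulmx1 mul_rowsub_mx mul1mx mxsubrc.
exact: leq_trans (mxrankM_maxl _ _) (mxrankM_maxr _ _).
Qed.

Lemma mxrank_mxsub_bij m n m' n' (f : 'I_m' -> 'I_m) (g : 'I_n' -> 'I_n)
    (A : 'M[F]_(m, n)) : bijective f -> bijective g ->
  \rank (mxsub f g A) = \rank A.
Proof.
move=> [f' fK f'K] [g' gK g'K]; apply/eqP; rewrite eqn_leq mxrank_mxsub /=.
suff {1}-> : A = mxsub f' g' (mxsub f g A) by exact: mxrank_mxsub.
by apply/matrixP => i j; rewrite !mxE f'K g'K.
Qed.

Lemma mxsub_join n (N : 'M[F]_n) p q p' q' (f : 'I_p -> 'I_n) (g : 'I_q -> 'I_n)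
    (f' : 'I_p' -> 'I_n) (g' : 'I_q' -> 'I_n) :
  mxsub (join_idx f g) (join_idx f' g') N =
  block_mx (mxsub f f' N) (mxsub f g' N) (mxsub g f' N) (mxsub g g' N).
Proof.
apply/matrixP => i j; rewrite -(splitK i) -(splitK j).
by case: (fintype.split i) (fintype.split j) => i' [] j' /=;
  rewrite ?block_mxEul ?block_mxEur ?block_mxEdl ?block_mxEdr
          !mxE ?join_idxl ?join_idxr.
Qed.

Lemma rowsub_join n p q (f : 'I_p -> 'I_n) (g : 'I_q -> 'I_n) (y : 'cV[F]_n) :
  rowsub (join_idx f g) y = col_mx (rowsub f y) (rowsub g y).
Proof.
apply/matrixP => i j; rewrite -(splitK i).
by case: (fintype.split i) => i' /=; rewrite ?col_mxEu ?col_mxEd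
          !mxE ?join_idxl ?join_idxr.
Qed.

End Reindexing.

(** * Quadratic forms *)

Section QuadraticForms.
Variable F : fieldType.

Definition quad n (T : 'M[F]_n) (w : 'cV[F]_n) : F := (w^T *m T *m w) 0 0.

Lemma quad_diag_block p q (P : 'M[F]_p) (S : 'M[F]_q) u v :
  quad (block_mx P 0 0 S) (col_mx u v) = quad P u + quad S v.
Proof.
rewrite /quad tr_col_mx mul_row_block mul_row_col !mulmx0 addr0 add0r.
by rewrite mxE.
Qed.

Lemma invmx_diag_block p q (P : 'M[F]_p) (S : 'M[F]_q) :
  P \in unitmx -> S \in unitmx ->
  invmx (block_mx P 0 0 S) = block_mx (invmx P) 0 0 (invmx S).
Proof.
move=> uP uS; apply: invmx_unique; rewrite mulmx_block !mulmxV //.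
by rewrite !mulmx0 !mul0mx !addr0 !add0r -scalar_mx_block.
Qed.

Lemma unitmx_ker0 n (M : 'M[F]_n) :
  (forall v : 'cV_n, M *m v = 0 -> v = 0) -> M \in unitmx.
Proof.
move=> k0; rewrite -unitmx_tr -row_free_unit; apply: inj_row_free => v vM.
apply: trmx_inj; rewrite trmx0; apply: k0.
by rewrite -[M]trmxK -trmx_mul vM trmx0.
Qed.

End QuadraticForms.

Lemma sym_quad0 (R : numFieldType) n (A : 'M[R]_n) : A^T = A ->
  (forall v : 'cV_n, quad A v = 0) -> A = 0.
Proof.
move=> sA q0.
(* Polarization: the bilinear form vanishes with the quadratic one. *)
have b0 (u v : 'cV_n) : (u^T *m A *m v) 0 0 = 0.
  have sym : (v^T *m A *m u) 0 0 = (u^T *m A *m v) 0 0.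
    rewrite -[in RHS]trace_mx11 -mxtrace_tr !trmx_mul trmxK sA mulmxA.
    by rewrite trace_mx11.
  have addE (X Y : 'M[R]_1) : (X + Y) 0 0 = X 0 0 + Y 0 0 by rewrite mxE.
  have := q0 (u + v).
  rewrite /quad [(u + v)^T]linearD !(mulmxDl, mulmxDr) !addE.
  rewrite -/(quad A u) -/(quad A v) !q0 sym.
  by rewrite add0r addr0 -mulr2n => /eqP; rewrite mulrn_eq0 => /eqP.
apply/matrixP => i j; have := b0 (delta_mx i 0) (delta_mx j 0).
by rewrite trmx_delta -rowE -colE !mxE.
Qed.

(** * Schur complements *)

Section Schur.
Variable F : fieldType.
Variables (n : nat) (M : 'M[F]_n).

(** The Schur complement of the block of [M] at [f], on all indices at once, so
    that [mxsub g g' (schur f)] is meaningful for all lists [g] and [g'].  When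
    [M] is a covariance matrix, this is the covariance of the residuals
    [resid f y] of the regression on the coordinates [f], hence the names. *)
Definition schur p (f : 'I_p -> 'I_n) : 'M[F]_n :=
  M - colsub f M *m invmx (mxsub f f M) *m rowsub f M.

Definition resid p (f : 'I_p -> 'I_n) (y : 'cV[F]_n) : 'cV[F]_n :=
  y - colsub f M *m invmx (mxsub f f M) *m rowsub f y.

Definition qform p (f : 'I_p -> 'I_n) (y : 'cV[F]_n) : F :=
  quad (invmx (mxsub f f M)) (rowsub f y).

Lemma mxsub_schur p q q' (f : 'I_p -> 'I_n) (g : 'I_q -> 'I_n)
    (g' : 'I_q' -> 'I_n) :
  mxsub g g' (schur f) =
  mxsub g g' M - mxsub g f M *m invmx (mxsub f f M) *m mxsub f g' M.
Proof.
rewrite /schur raddfB /=; congr (_ - _).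
by rewrite mxsub_mul -mul_rowsub_mx -!mxsub_comp.
Qed.

Lemma rowsub_resid p q (f : 'I_p -> 'I_n) (g : 'I_q -> 'I_n) (y : 'cV[F]_n) :
  rowsub g (resid f y) =
  rowsub g y - mxsub g f M *m invmx (mxsub f f M) *m rowsub f y.
Proof.
by rewrite /resid raddfB /= -!mul_rowsub_mx -mxsub_comp.
Qed.

(** Gaussian elimination with the invertible block at [f] as the pivot.  The two
    index lists share [f] but may go on with different [g] and [g'], so that
    this also applies to the matrix of the rank condition, which need not be
    square. *)
Lemma schur_factor p q q' (f : 'I_p -> 'I_n) (g : 'I_q -> 'I_n)
    (g' : 'I_q' -> 'I_n) : mxsub f f M \in unitmx ->
  mxsub (join_idx f g) (join_idx f g') M =
  block_mx 1%:M 0 (mxsub g f M *m invmx (mxsub f f M)) 1%:M *m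
  block_mx (mxsub f f M) 0 0 (mxsub g g' (schur f)) *m
  block_mx 1%:M (invmx (mxsub f f M) *m mxsub f g' M) 0 1%:M.
Proof.
move=> uP; rewrite mxsub_join !mulmx_block mxsub_schur.
rewrite ?(mul1mx, mulmx1, mul0mx, mulmx0, addr0, add0r) mulKVmx // mulmxKV //.
by rewrite mulmxA addrC subrK.
Qed.

Lemma mxrank_join p q q' (f : 'I_p -> 'I_n) (g : 'I_q -> 'I_n)
    (g' : 'I_q' -> 'I_n) : mxsub f f M \in unitmx ->
  \rank (mxsub (join_idx f g) (join_idx f g') M) =
  (p + \rank (mxsub g g' (schur f)))%N.
Proof.
move=> uP; rewrite schur_factor // mxrankMfree ?row_free_unit; last first.
  by rewrite unitmxE det_ublock !det1 mulr1 unitr1.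
rewrite eqmxMfull ?row_full_unit; last first.
  by rewrite unitmxE det_lblock !det1 mulr1 unitr1.
by rewrite rank_diag_block_mx mxrank_unit.
Qed.

Lemma det_join p q (f : 'I_p -> 'I_n) (g : 'I_q -> 'I_n) :
  mxsub f f M \in unitmx ->
  \det (mxsub (join_idx f g) (join_idx f g) M) =
  \det (mxsub f f M) * \det (mxsub g g (schur f)).
Proof.
move=> uP; rewrite schur_factor // !det_mulmx !det_lblock det_ublock !det1.
by rewrite !mulr1 mul1r.
Qed.

(** Completing the square: [schur_factor] reads L D L^T with D block diagonal,
    and L maps (y_f, residual) to (y_f, y_g), so that the form of the inverse
    of L D L^T at (y_f, y_g) is the one of the inverse of D at
    (y_f, residual). *)
Lemma qform_join p q (f : 'I_p -> 'I_n) (g : 'I_q -> 'I_n) (y : 'cV[F]_n) :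
  M^T = M -> mxsub f f M \in unitmx -> mxsub g g (schur f) \in unitmx ->
  qform (join_idx f g) y =
  qform f y + quad (invmx (mxsub g g (schur f))) (rowsub g (resid f y)).
Proof.
move=> sM uP uS; rewrite /qform rowsub_join.
set P := mxsub f f M; set S := mxsub g g (schur f).
set u := rowsub f y; set r := rowsub g (resid f y).
set X := mxsub _ _ M.
have uX : X \in unitmx by rewrite unitmxE det_join // unitrM -!unitmxE uP.
pose L := block_mx 1%:M 0 (mxsub g f M *m invmx P) 1%:M.
have -> : col_mx u (rowsub g y) = L *m col_mx u r.
  rewrite mul_block_col !mul1mx mul0mx addr0 /r rowsub_resid addrC.
  by rewrite subrK.
have uL : L \in unitmx by rewrite unitmxE det_lblock !det1 mulr1 unitr1.
have sP : P^T = P by rewrite trmx_mxsub sM.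
have eX : X = L *m block_mx P 0 0 S *m L^T.
  rewrite /X schur_factor // tr_block_mx !trmx1 !trmx0 trmx_mul trmx_inv sP.
  by rewrite trmx_mxsub sM.
have -> : quad (invmx X) (L *m col_mx u r) =
          quad (L^T *m invmx X *m L) (col_mx u r).
  by rewrite /quad trmx_mul !mulmxA.
have <- : invmx (block_mx P 0 0 S) = L^T *m invmx X *m L.
  apply: invmx_unique.
  have -> : block_mx P 0 0 S *m (L^T *m invmx X *m L) =
            invmx L *m (L *m block_mx P 0 0 S *m L^T) *m invmx X *m L.
    by rewrite !mulmxA mulVmx // mul1mx.
  by rewrite -eX -(mulmxA _ X) mulmxV // mulmx1 mulVmx.
by rewrite invmx_diag_block // quad_diag_block.
Qed.

Lemma qform_bij p q (f : 'I_p -> 'I_n) (g : 'I_q -> 'I_n)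
    (s : 'I_q -> 'I_p) y : bijective s -> g =1 f \o s ->
  mxsub f f M \in unitmx -> qform g y = qform f y.
Proof.
move=> sB gf uf; rewrite /qform /quad.
have -> : mxsub g g M = mxsub s s (mxsub f f M).
  by rewrite -mxsub_comp; apply: eq_mxsub.
have [_ ->] := mxsub_bij_inv sB uf.
have -> : rowsub g y = rowsub s (rowsub f y).
  by rewrite -mxsub_comp; apply: eq_mxsub.
by rewrite trmx_mxsub !mulmx_mxsub_bij // mxE.
Qed.

End Schur.

Lemma tr_schur (F : fieldType) n (M : 'M[F]_n) p (f : 'I_p -> 'I_n) :
  M^T = M -> (schur M f)^T = schur M f.
Proof.
move=> sM; rewrite /schur raddfB /= !trmx_mul trmx_inv !trmx_mxsub sM.
by rewrite mulmxA.
Qed.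


(** * Positive definite matrices *)

Section PositiveDefinite.
Variable R : realFieldType.

Definition posdef n (T : 'M[R]_n) : Prop :=
  T^T = T /\ forall w : 'cV[R]_n, w != 0 -> 0 < quad T w.

Lemma quad_border n (s : R) (r : 'cV[R]_n) (T : 'M[R]_n) (a : R)
    (w : 'cV[R]_n) : s != 0 ->
  quad (block_mx s%:M r^T r T) (col_mx a%:M w) =
  s * (a + s^-1 * (r^T *m w) 0 0) ^+ 2 + quad (T - s^-1 *: (r *m r^T)) w.
Proof.
move=> s0; rewrite /quad tr_col_mx tr_scalar_mx mul_row_block mul_row_col.
set b := (r^T *m w) 0 0.
have e1 : r^T *m w = b%:M by rewrite [LHS]mx11_scalar.
have e2 : w^T *m r = b%:M by rewrite -[LHS]trmxK trmx_mul trmxK e1 tr_scalar_mx.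
rewrite !mulmxDl !mulmxBr !mulmxBl e2 -!scalemxAr -!scalemxAl !mulmxA e2.
rewrite -!mulmxA e1 -!scalar_mxM [X in _ = _ + X]mxE !mxE /= !mulr1n.
by field.
Qed.

Lemma det_border n (s : R) (r : 'cV[R]_n) (T : 'M[R]_n) : s != 0 ->
  \det (block_mx s%:M r^T r T) = s * \det (T - s^-1 *: (r *m r^T)).
Proof.
move=> s0; set X := block_mx _ _ _ _.
have e : X *m block_mx 1%:M (- s^-1 *: r^T) 0 1%:M =
         block_mx s%:M 0 r (T - s^-1 *: (r *m r^T)).
  rewrite mulmx_block !mulmx1 !mulmx0 !addr0 mul_scalar_mx scalerA mulrN.
  by rewrite divff // scaleN1r addNr -scalemxAr scaleNr addrC.
have := congr1 (fun A => \det A) e; rewrite det_mulmx det_ublock det_lblock.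
by rewrite !det1 !mulr1 det_scalar1.
Qed.

(** Peeling off the first coordinate: the square in [quad_border] vanishes for a
    suitable first entry, so the Schur complement of the positive corner is
    positive definite again.  All inductions on the dimension rest on this. *)
Lemma posdef_border n (T : 'M[R]_(1 + n)) : posdef T ->
  exists s r T', [/\ T = block_mx s%:M r^T r T', 0 < s &
    posdef (T' - s^-1 *: (r *m r^T))].
Proof.
move=> [sT pT]; pose s := ulsubmx T 0 0.
have eT : T = block_mx s%:M (dlsubmx T)^T (dlsubmx T) (drsubmx T).
  rewrite -[LHS]submxK [ulsubmx T]mx11_scalar -/s; congr block_mx.
  by rewrite -{1}sT -trmx_dlsub.
exists s, (dlsubmx T), (drsubmx T).
have pB w : w != 0 ->
    0 < quad (block_mx s%:M (dlsubmx T)^T (dlsubmx T) (drsubmx T)) w.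
  by rewrite -eT; exact: pT.
have s0 : 0 < s.
  have := pB (col_mx 1%:M 0); rewrite /quad tr_col_mx trmx1 trmx0.
  rewrite mul_row_block mul_row_col !mulmx0 addr0 mul1mx mul0mx !addr0 mulmx1.
  rewrite !mxE eqxx mulr1n; apply; rewrite col_mx_eq0 negb_and.
  by apply/orP; left; apply/eqP => /matrixP/(_ 0 0)/eqP; rewrite !mxE oner_eq0.
split => //; split.
  rewrite raddfB /= linearZ /= trmx_mul trmxK; congr (_ - _).
  by rewrite trmx_drsub sT.
move=> w w0; set b := ((dlsubmx T)^T *m w) 0 0.
have := pB (col_mx (- s^-1 * b)%:M w).
rewrite quad_border ?gt_eqF // -/b mulNr addNr expr0n mulr0 add0r; apply.
by rewrite col_mx_eq0 negb_and w0 orbT.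
Qed.

Lemma posdef_det_gt0 n (T : 'M[R]_n) : posdef T -> 0 < \det T.
Proof.
elim: n T => [|n IH] T pT; first by rewrite det_mx00.
have [s [r [T' [-> s0 pS]]]] := posdef_border (pT : posdef (T : 'M[R]_(1 + n))).
by rewrite det_border ?gt_eqF // mulr_gt0 // IH.
Qed.

End PositiveDefinite.

(** * The Gaussian integral on tuples *)

Section Gaussian.
Variable R : realType.
Local Notation vec n := (n.-tuple (measurableTypeR R)).
Local Notation mu := (@lebesgue_measure R).

Definition coords n (z : vec n) : 'cV[R]_n := \col_i tnth z i.

Lemma coords_tcons n (x : R) (t : vec n) :
  coords (tcons (x, t)) = col_mx x%:M (coords t) :> 'cV_(1 + n).
Proof.
apply/matrixP => i j; rewrite (ord1 j) -(splitK i) /=.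
case: (fintype.split i) => k /=.
  by rewrite (ord1 k) col_mxEu !mxE eqxx mulr1n.
rewrite col_mxEd !mxE (_ : rshift 1 k = lift ord0 k) ?tnthS //.
exact: val_inj.
Qed.

Lemma integral_lebesgue_tupleS n (f : vec n.+1 -> \bar R) :
  measurable_fun setT f -> (forall z, 0 <= f z)%E ->
  (\int[lebesgue_tuple n.+1]_z f z =
   \int[lebesgue_tuple n]_t \int[mu]_x f (tcons (x, t)))%E.
Proof.
move=> mf f0.
have mc := @measurable_tcons R n.
rewrite (eq_measure_integral
  (pushforward (mu \x lebesgue_tuple n)%E (@tcons R n))) //.
rewrite ge0_integral_pushforward // preimage_setT.
by rewrite (fubini_tonelli2 (f \o @tcons R n)) //;
  [exact: (measurableT_comp mf mc) | move=> p; exact: f0].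
Qed.

Lemma integral_gauss1 (s m : R) : 0 < s ->
  (\int[mu]_x (expR (- 2^-1 * (s * (x - m) ^+ 2)))%:E =
   (Num.sqrt (2 * pi / s))%:E)%E.
Proof.
move=> s0; pose sg := Num.sqrt s^-1.
have sg0 : sg != 0 by rewrite gt_eqF // sqrtr_gt0 invr_gt0.
have sg2 : sg ^+ 2 = s^-1 by rewrite sqr_sqrtr // invr_ge0 ltW.
have pk : normal_peak sg = (Num.sqrt (2 * pi / s))^-1.
  by rewrite /normal_peak sg2; congr (Num.sqrt _)^-1; rewrite -mulr_natl; ring.
have sq0 : 0 < Num.sqrt (2 * pi / s).
  by rewrite sqrtr_gt0 divr_gt0 // mulr_gt0 // pi_gt0.
transitivity
    (\int[mu]_x ((Num.sqrt (2 * pi / s))%:E * (normal_pdf m sg x)%:E))%E.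
  apply: eq_integral => x _; rewrite normal_pdfE // pk -EFinM mulVKf ?gt_eqF //.
  rewrite /normal_fun sg2; congr (expR _)%:E.
  by field; rewrite gt_eqF.
rewrite integralZl ?integral_normal_pdf ?mule1 //.
exact: integrable_normal_pdf.
Qed.

Lemma measurable_quad n (T : 'M[R]_n) (z0 : 'cV[R]_n) :
  measurable_fun setT (fun z : vec n => quad T (coords z - z0)).
Proof.
have -> : (fun z : vec n => quad T (coords z - z0)) = fun z =>
    \sum_j (\sum_i (tnth z i - z0 i 0) * T i j) * (tnth z j - z0 j 0).
  apply/funext => z; rewrite /quad mxE; apply: eq_bigr => j _.
  by rewrite !mxE; congr (_ * _); apply: eq_bigr => i _; rewrite !mxE.
have md i : measurable_fun setT (fun z : vec n => tnth z i - z0 i 0).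
  by apply: measurable_funB => //; exact: measurable_tnth.
apply: measurable_sum => j; apply: measurable_funM => //.
by apply: measurable_sum => i; exact: measurable_funM.
Qed.

Lemma measurable_gauss n (T : 'M[R]_n) (z0 : 'cV[R]_n) :
  measurable_fun setT
    (fun z : vec n => (expR (- 2^-1 * quad T (coords z - z0)))%:E).
Proof.
apply/measurable_EFinP; apply: measurableT_comp => //.
by apply: measurable_funM => //; exact: measurable_quad.
Qed.

(** Integrating out the first coordinate of the Gaussian with precision matrix
    [T], by completing the square in it, leaves the Gaussian of the Schur
    complement of the corner.  The center [z0] is arbitrary because this step
    turns it into an arbitrary center in dimension one. *)
Lemma integral_gauss n (T : 'M[R]_n) (z0 : 'cV[R]_n) : posdef T ->
  (\int[lebesgue_tuple n]_z (expR (- 2^-1 * quad T (coords z - z0)))%:E =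
   (Num.sqrt ((2 * pi) ^+ n / \det T))%:E)%E.
Proof.
elim: n T z0 => [|n IH]; last rewrite -[n.+1]/(1 + n)%N.
  move=> T z0 pT; rewrite /= integral_dirac //; last exact: measurable_gauss.
  rewrite diracT mul1e /quad [coords _ - _]flatmx0 mulmx0 mxE mulr0 expR0.
  by rewrite det_mx00 expr0 divr1 sqrtr1.
move=> T z0 pT; rewrite integral_lebesgue_tupleS //; last first.
  exact: measurable_gauss.
have [s [r [T' [eT s0 pS]]]] := posdef_border pT.
set S := T' - _ in pS.
pose x0 := usubmx z0 0 0; pose t0 := dsubmx z0.
have ez : z0 = col_mx x0%:M t0.
  by rewrite -[LHS]vsubmxK [usubmx _]mx11_scalar.
transitivity (\int[lebesgue_tuple n]_t ((Num.sqrt (2 * pi / s))%:E *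
    (expR (- 2^-1 * quad S (coords t - t0)))%:E))%E.
  apply: eq_integral => t _.
  (* The center in the first coordinate, given the other ones. *)
  pose m := x0 - s^-1 * (r^T *m (coords t - t0)) 0 0.
  transitivity (\int[mu]_x ((expR (- 2^-1 * quad S (coords t - t0)))%:E *
     (expR (- 2^-1 * (s * (x - m) ^+ 2)))%:E))%E.
    apply: eq_integral => x _; rewrite -EFinM -expRD; congr (expR _)%:E.
    rewrite [T]eT ez coords_tcons opp_col_mx add_col_mx -raddfB /=.
    rewrite quad_border ?gt_eqF // -/S /m; ring.
  rewrite ge0_integralZl ?integral_gauss1 1?muleC //.
  apply/measurable_EFinP; apply: measurableT_comp => //.
  apply: measurable_funM => //; apply: measurable_funM => //.
  by apply: measurable_funX; exact: measurable_funB.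
rewrite ge0_integralZl //; last exact: measurable_gauss.
  rewrite IH // -EFinM -sqrtrM; last first.
    by rewrite divr_ge0 ?ltW // mulr_gt0 // pi_gt0.
  rewrite [T]eT det_border ?gt_eqF // -/S exprS; congr (Num.sqrt _)%:E.
  by field; rewrite !gt_eqF // posdef_det_gt0.
Qed.

End Gaussian.

(** * Bordered matrices of conditionally negative definite matrices *)

Section CayleyMenger.
Variable R : realType.

Definition border_idx p d (f : 'I_p -> 'I_d) : 'I_(p + 1) -> 'I_(d + 1) :=
  join_idx (lshift 1 \o f) (@rshift d 1).

Lemma CM_mxsub m n p q (f : 'I_p -> 'I_m) (g : 'I_q -> 'I_n)
    (G : 'M[R]_(m, n)) :
  CM (mxsub f g G) = mxsub (border_idx f) (border_idx g) (CM G).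
Proof.
apply/matrixP => i j; rewrite [RHS]mxE -(splitK i) -(splitK j) /border_idx.
case: (fintype.split i) (fintype.split j) => i' [] j' /=;
  by rewrite ?join_idxl ?join_idxr /CM /=
  ?block_mxEul ?block_mxEur ?block_mxEdl ?block_mxEdr !mxE.
Qed.

Lemma border_idx_inj p d (f : 'I_p -> 'I_d) :
  injective f -> injective (border_idx f).
Proof.
move=> fI; apply: join_idx_inj => [i j /lshift_inj /fI//||i j].
  exact: rshift_inj.
by rewrite eq_lrshift.
Qed.

Lemma tr_CM d (G : 'M[R]_d) : G^T = G -> (CM G)^T = CM G.
Proof. by move=> sG; rewrite /CM tr_block_mx !trmx_const linearZ /= sG. Qed.

Lemma strictly_cnd_mxsub p d (f : 'I_p -> 'I_d) (G : 'M[R]_d) :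
  injective f -> strictly_cnd G -> strictly_cnd (mxsub f f G).
Proof.
move=> fI [sG dG nG]; split=> [|i|v v0 sv]; first by rewrite trmx_mxsub sG.
  by rewrite mxE.
(* [J^T *m v] extends [v] by zero outside the range of [f]. *)
pose J : 'M[R]_(p, d) := rowsub f 1%:M.
have JJ : J *m J^T = 1%:M.
  rewrite /J trmx_mxsub trmx1 mul_rowsub_mx mul1mx -mxsub_comp.
  by apply/matrixP => i j; rewrite !mxE (inj_eq fI).
have eG : mxsub f f G = J *m G *m J^T.
  rewrite /J mul_rowsub_mx mul1mx trmx_mxsub trmx1 mulmx_colsub mulmx1.
  by rewrite -mxsub_comp.
have := nG (J^T *m v); rewrite trmx_mul trmxK !mulmxA -[v^T *m J *m G]mulmxA.
rewrite -[v^T *m (J *m G) *m J^T]mulmxA -eG; apply.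
  apply/eqP => e; move: v0.
  by rewrite -[v]mul1mx -JJ -mulmxA e mulmx0 eqxx.
rewrite -[RHS]sv; under eq_bigr do rewrite mxE.
rewrite exchange_big /=; apply: eq_bigr => j _.
rewrite -mulr_suml (bigD1 (f j)) //= !mxE eqxx big1 ?addr0 ?mul1r // => i.
by rewrite !mxE eq_sym => /negPf ->.
Qed.

Lemma CM_mul d (G : 'M[R]_d) (v : 'cV[R]_d) (s : R) :
  CM G *m col_mx v s%:M =
  col_mx (- 2^-1 *: (G *m v) + const_mx s) (\sum_i v i 0)%:M.
Proof.
rewrite /CM mul_block_col mul0mx addr0 -scalemxAl; congr col_mx.
  congr (_ + _); apply/matrixP => i j.
  by rewrite !mxE big_ord1 !mxE (ord1 j) eqxx mulr1n mul1r.
apply/matrixP => i j; rewrite !mxE !ord1 eqxx mulr1n.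
by apply: eq_bigr => k _; rewrite mxE mul1r.
Qed.

Lemma quad_CM d (G : 'M[R]_d) (v : 'cV[R]_d) (s : R) : \sum_i v i 0 = 0 ->
  quad (CM G) (col_mx v s%:M) = - 2^-1 * quad G v.
Proof.
move=> sv; rewrite /quad -mulmxA CM_mul sv tr_col_mx mul_row_col raddf0 mulmx0.
rewrite addr0 mulmxDr -scalemxAr !mulmxA.
have -> : v^T *m (const_mx s : 'cV_d) = 0.
  apply/matrixP => i j; rewrite !mxE -[RHS](mul0r s) -[in RHS]sv mulr_suml.
  by apply: eq_bigr => k _; rewrite !mxE (ord1 i).
by rewrite addr0 mxE.
Qed.

(** The part outside the border of a kernel vector has zero sum, and the form of
    [G] vanishes at it, so that this part is zero; then the entry on the border
    is zero as well. *)
Lemma unitmx_CM d (G : 'M[R]_d) :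
  (0 < d)%N -> strictly_cnd G -> CM G \in unitmx.
Proof.
case: d G => // d G _ [sG dG nG]; apply: unitmx_ker0 => w w0.
have ew : w = col_mx (usubmx w) (dsubmx w 0 0)%:M.
  by rewrite -mx11_scalar vsubmxK.
have := w0; rewrite ew CM_mul => /eqP; rewrite col_mx_eq0.
move=> /andP[/eqP e1 /eqP e2].
have sv : \sum_i usubmx w i 0 = 0.
  by have /matrixP/(_ 0 0) := e2; rewrite !mxE eqxx mulr1n.
have v0 : usubmx w = 0.
  apply/eqP/negP => /negP v0; have := nG _ v0 sv.
  have := quad_CM G (dsubmx w 0 0) sv.
  rewrite -ew {1}/quad -mulmxA w0 mulmx0 mxE /quad => /esym /eqP.
  rewrite mulf_eq0 oppr_eq0 invr_eq0 pnatr_eq0 /= => /eqP ->.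
  by rewrite ltxx.
move: e1; rewrite v0 mulmx0 scaler0 add0r => /matrixP/(_ 0 0).
rewrite [LHS]mxE [RHS]mxE => ->.
by rewrite raddf0 col_mx0.
Qed.

(** Write [y] as [CM G *m col_mx v s].  The last entry of [y], which is zero, is
    the sum of [v], so the form at [y] is -1/2 times the one of [G] at [v], and
    it remains to see that [v] is nonzero.  For [v = 0] the vector [y] would be
    constant outside the border, hence zero by the coordinate [i0]. *)
Lemma quad_invCM_gt0 d (G : 'M[R]_d) (i0 : 'I_d) (y : 'cV[R]_(d + 1)) :
  strictly_cnd G -> y (rshift d 0) 0 = 0 -> y (lshift 1 i0) 0 = 0 -> y != 0 ->
  0 < quad (invmx (CM G)) y.
Proof.
move=> cG yb yi y0; have [sG dG nG] := cG.
have uM : CM G \in unitmx.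
  by apply: unitmx_CM => //; exact: leq_ltn_trans (ltn_ord i0).
pose w := invmx (CM G) *m y.
have ey : y = CM G *m w by rewrite mulKVmx.
have -> : quad (invmx (CM G)) y = quad (CM G) w.
  by rewrite /quad /w trmx_mul trmx_inv tr_CM // mulmxKV // mulmxA.
have ew : w = col_mx (usubmx w) (dsubmx w 0 0)%:M.
  by rewrite -mx11_scalar vsubmxK.
move: ey; rewrite {1}ew CM_mul => ey.
have sv : \sum_i usubmx w i 0 = 0.
  by move: yb; rewrite ey col_mxEd mxE eqxx mulr1n.
rewrite ew quad_CM // mulNr -mulrN pmulr_rgt0 ?invr_gt0 // oppr_gt0.
apply: nG => //; apply: contra y0 => /eqP v0; move: yi.
rewrite ey sv v0 mulmx0 scaler0 add0r.
by rewrite col_mxEu mxE => ->; rewrite !raddf0 col_mx0.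
Qed.

Section Complement.
Variables (p q d : nat) (G : 'M[R]_d) (f : 'I_p -> 'I_d) (g : 'I_q -> 'I_d).
Hypotheses (cG : strictly_cnd G) (p0 : (0 < p)%N) (fI : injective f).
Let M := CM G.
Let g1 : 'I_q -> 'I_(d + 1) := lshift 1 \o g.
Let h := join_idx (border_idx f) g1.
Hypothesis hB : bijective h.

(** By [qform_join] the form in question, at [w], is the one of the inverse of
    [CM G] at the vector that is [w] on [g] and zero on [f] and on the border,
    and [quad_invCM_gt0] applies since [f] is nonempty. *)
Lemma posdef_inv_schur :
  mxsub g1 g1 (schur M (border_idx f)) \in unitmx /\
  posdef (invmx (mxsub g1 g1 (schur M (border_idx f)))).
Proof.
pose i0 : 'I_d := f (Ordinal p0).
have sM : M^T = M by apply: tr_CM; case: cG.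
have uM : M \in unitmx.
  by apply: unitmx_CM => //; exact: leq_ltn_trans (ltn_ord i0).
have uP : mxsub (border_idx f) (border_idx f) M \in unitmx.
  by rewrite -CM_mxsub; apply: unitmx_CM => //; exact: strictly_cnd_mxsub.
set S := mxsub _ _ _.
have uS : S \in unitmx.
  have := det_mxsub_bij M hB; rewrite det_join // -/S => e.
  by move: uM; rewrite unitmxE -e unitrM => /andP[_]; rewrite -unitmxE.
split => //; split; first by rewrite trmx_inv trmx_mxsub tr_schur.
move=> w w0; have [k hk kh] := hB.
pose y : 'cV[R]_(d + 1) := rowsub k (col_mx 0 w).
have : rowsub h y = col_mx 0 w.
  rewrite /y -mxsub_comp -[RHS]mxsub_id.
  by apply: eq_mxsub => // i /=; rewrite hk.
rewrite rowsub_join => /eq_col_mx[yf yg].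
have := qform_join y sM uP uS; rewrite rowsub_resid yf mulmx0 subr0 yg.
rewrite [qform _ (border_idx f) _]/qform yf [X in X + _]/quad mulmx0.
rewrite [X in X + _]mxE add0r => <-; rewrite /qform.
have [_ ->] := mxsub_bij_inv hB uM.
rewrite /quad trmx_mxsub !mulmx_mxsub_bij // mxsub_id -/(quad _ _).
apply: (@quad_invCM_gt0 _ _ i0) => //.
- have /matrixP/(_ (rshift p 0) 0) := yf.
  by rewrite !mxE /border_idx join_idxr.
- have /matrixP/(_ (lshift 1 (Ordinal p0)) 0) := yf.
  by rewrite !mxE /border_idx join_idxl.
- apply: contra w0 => /eqP y0; rewrite -yg y0.
  by apply/eqP/matrixP => i j; rewrite !mxE.
Qed.

Lemma det_CM_complement :
  \det M = \det (CM (mxsub f f G)) *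
    \det (mxsub g1 g1 (schur M (border_idx f))).
Proof.
rewrite -(det_mxsub_bij M hB) det_join ?CM_mxsub //.
by rewrite -CM_mxsub; apply: unitmx_CM => //; exact: strictly_cnd_mxsub.
Qed.

End Complement.

Lemma bij_complement p q d (f : 'I_p -> 'I_d) (g : 'I_q -> 'I_d) :
  injective f -> injective g -> (forall i j, f i != g j) -> (p + q = d)%N ->
  bijective (join_idx (border_idx f) (lshift 1 \o g)).
Proof.
move=> fI gI fg pq; apply: inj_card_bij; last by rewrite !card_ord -pq addnAC.
apply: join_idx_inj => [||i j].
- exact: border_idx_inj.
- by move=> i j /lshift_inj /gI.
rewrite -(splitK i); case: (fintype.split i) => k /=; rewrite /border_idx.
  by rewrite join_idxl (inj_eq (@lshift_inj _ _)).
by rewrite join_idxr eq_rlshift.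
Qed.

Lemma det_CM1 (G : 'M[R]_1) : G 0 0 = 0 -> \det (CM G) = -1.
Proof.
move=> G0; have -> : CM G = block_mx 0 1%:M 1%:M 0.
  have one : const_mx 1 = 1%:M :> 'M[R]_1.
    by apply/matrixP => i j; rewrite !ord1 !mxE.
  rewrite /CM one; congr block_mx; apply/matrixP => i j.
  by rewrite !ord1 !mxE G0 mulr0.
(* Two column operations make the exchange matrix triangular. *)
have e : block_mx 0 1%:M 1%:M 0 *m block_mx 1%:M 0 1%:M 1%:M *m
         block_mx 1%:M (- 1%:M) 0 1%:M =
         block_mx 1%:M 0 1%:M (- 1%:M) :> 'M[R]_(1 + 1).
  rewrite !mulmx_block !(mul0mx, mulmx0, mul1mx, mulmx1, addr0, add0r).
  by rewrite addNr.
have := congr1 (fun A => \det A) e.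
by rewrite !det_mulmx !det_lblock det_ublock !det1 !mulr1 mul1r -scaleN1r detZ
  det1 mulr1 expr1.
Qed.

(** The block of one coordinate and the border has determinant -1, and its
    Schur complement is positive definite. *)
Lemma det_CM_lt0 d (G : 'M[R]_d) :
  (0 < d)%N -> strictly_cnd G -> \det (CM G) < 0.
Proof.
case: d G => // d G _ cG.
pose f (_ : 'I_1) : 'I_d.+1 := ord0.
have fI : injective f by move=> i j _; rewrite !ord1.
have hB : bijective (join_idx (border_idx f) (lshift 1 \o lift (@ord0 d))).
  by apply: bij_complement => //; exact: lift_inj.
have [uS pS] := posdef_inv_schur cG (ltn0Sn 0) fI hB.
rewrite (det_CM_complement cG (ltn0Sn 0) fI hB) det_CM1; last first.
  by rewrite mxE; case: cG.
by rewrite mulN1r oppr_lt0 -invr_gt0 -det_inv posdef_det_gt0.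
Qed.

End CayleyMenger.

(** * Marginal exponent measure densities *)

Section Marginal.
Variable R : realType.
Local Notation vec n := (n.-tuple (measurableTypeR R)).
Variables (d : nat) (G : 'M[R]_d).
Hypothesis cG : strictly_cnd G.

Definition point1 (y : vec d) : 'cV[R]_(d + 1) := col_mx (coords y) 1%:M.

(** The constant of a marginal density after integrating out [m] coordinates,
    when the bordered matrix of the remaining ones has determinant [x]. *)
Definition hr_const (m : nat) (x : R) : R :=
  (Num.sqrt (- \det (CM ((2 * pi) *: G))))^-1 *
  Num.sqrt ((2 * pi) ^+ m * (\det (CM G) / x)).

Lemma hr_const_gt0 m x : (0 < d)%N -> x < 0 -> 0 < hr_const m x.
Proof.
move=> d0 x0; have pi2 : 0 < 2 * pi :> R by rewrite mulr_gt0 ?pi_gt0.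
rewrite /hr_const mulr_gt0 //.
  rewrite invr_gt0 sqrtr_gt0 oppr_gt0; apply: det_CM_lt0 => //.
  case: cG => sG dG nG; split => [|i|v v0 sv].
  - by rewrite linearZ /= sG.
  - by rewrite mxE dG mulr0.
  - by rewrite -scalemxAr -scalemxAl mxE pmulr_rlt0 // nG.
rewrite sqrtr_gt0 pmulr_rgt0 ?exprn_gt0 //.
by rewrite nmulr_rgt0 ?invr_lt0 ?det_CM_lt0.
Qed.

Lemma hr_const_mul m1 m2 m3 m4 x1 x2 x3 x4 : (0 < d)%N ->
  x1 < 0 -> x3 < 0 -> (m1 + m2 = m3 + m4)%N -> x1 * x2 = x3 * x4 ->
  hr_const m1 x1 * hr_const m2 x2 = hr_const m3 x3 * hr_const m4 x4.
Proof.
move=> d0 x10 x30 em ex; rewrite /hr_const mulrACA [RHS]mulrACA.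
congr (_ * _).
have ge0 m x : x < 0 -> 0 <= (2 * pi) ^+ m * (\det (CM G) / x).
  move=> x0; rewrite pmulr_rge0 ?exprn_gt0 ?mulr_gt0 ?pi_gt0 //.
  by rewrite ltW // nmulr_rgt0 ?invr_lt0 ?det_CM_lt0.
rewrite -!sqrtrM ?ge0 //; congr Num.sqrt.
rewrite mulrACA [RHS]mulrACA -!exprD em; congr (_ * _).
by rewrite mulrACA [RHS]mulrACA -!invfM ex.
Qed.

Lemma glue_in (D : {set 'I_d}) (u : vec #|D|) (z : vec #|~: D|) (i : 'I_#|D|) :
  tnth (Defs.glue u z) (enum_val i) = tnth u i.
Proof.
rewrite tnth_mktuple enum_valP (tnth_nth 0); congr (nth _ _ _).
by rewrite (enum_val_nth (enum_val i)) index_uniq ?enum_uniq // -cardE.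
Qed.

Lemma glue_out (D : {set 'I_d}) (u : vec #|D|) (z : vec #|~: D|)
    (i : 'I_#|~: D|) : tnth (Defs.glue u z) (enum_val i) = tnth z i.
Proof.
rewrite tnth_mktuple; have := enum_valP i; rewrite inE => /negPf ->.
rewrite (tnth_nth 0); congr (nth _ _ _).
by rewrite (enum_val_nth (enum_val i)) index_uniq ?enum_uniq // -cardE.
Qed.

(** Completing the square with respect to [D], the coordinates outside [D] enter
    through a Gaussian whose center depends on [y] but whose integral does
    not. *)
Lemma marginal_hr (D : {set 'I_d}) (y : vec d) : D != finset.set0 ->
  let f := border_idx (@enum_val _ (mem D)) in
  Defs.marginal (hr_density G) (Defs.restrict D y) =
  (hr_const #|~: D| (\det (mxsub f f (CM G))) *
   expR (- 2^-1 * qform (CM G) f (point1 y)))%:E.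
Proof.
move=> D0 f; pose g : 'I_#|~: D| -> 'I_(d + 1) := lshift 1 \o enum_val.
have p0 : (0 < #|D|)%N by rewrite card_gt0.
have hB : bijective (join_idx f g).
  apply: bij_complement => [i j|i j|i j|]; try exact: enum_val_inj.
    have := enum_valP j; rewrite inE.
    by apply: contra => /eqP <-; exact: enum_valP.
  by rewrite cardsC card_ord.
have [sG _ _] := cG.
have [uS pS] := posdef_inv_schur cG p0 enum_val_inj hB.
set S := mxsub _ _ _ in uS pS.
have d0 : (0 < d)%N.
  by apply: leq_trans p0 _; rewrite -[d in (_ <= d)%N]card_ord max_card.
have uM := unitmx_CM d0 cG.
have uP : mxsub f f (CM G) \in unitmx.
  rewrite -CM_mxsub; apply: unitmx_CM => //.
  by apply: strictly_cnd_mxsub => //; exact: enum_val_inj.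
pose z0 := mxsub g f (CM G) *m invmx (mxsub f f (CM G)) *m rowsub f (point1 y).
pose c1 := (Num.sqrt (- \det (CM ((2 * pi) *: G))))^-1.
pose q := expR (- 2^-1 * qform (CM G) f (point1 y)).
have dens z : hr_density G (Defs.glue (Defs.restrict D y) z) =
    c1 * q * expR (- 2^-1 * quad (invmx S) (coords z - z0)).
  rewrite /hr_density -/c1 -mulrA; congr (_ * _).
  rewrite /q -expRD -mulrDr; congr (expR (_ * _)).
  set y' := Defs.glue _ _; rewrite -/(coords y') -/(point1 y').
  have yf : rowsub f (point1 y') = rowsub f (point1 y).
    apply/matrixP => i j; rewrite [LHS]mxE [RHS]mxE -(splitK i) /f /border_idx.
    case: (fintype.split i) => k /=; rewrite ?join_idxl ?join_idxr.
      by rewrite !col_mxEu !mxE glue_in tnth_mktuple.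
    by rewrite !col_mxEd.
  have yg : rowsub g (point1 y') = coords z.
    by apply/matrixP => i j; rewrite mxE /g /= col_mxEu !mxE glue_out.
  have := qform_join (point1 y') (tr_CM sG) uP uS.
  rewrite rowsub_resid yf yg -/z0 => e.
  have -> : qform (CM G) f (point1 y) = qform (CM G) f (point1 y').
    by rewrite /qform yf.
  rewrite -e /qform.
  have [_ ->] := mxsub_bij_inv hB uM.
  by rewrite /quad trmx_mxsub !mulmx_mxsub_bij // mxsub_id.
rewrite /marginal; under eq_integral do rewrite dens EFinM.
rewrite ge0_integralZl //.
- rewrite integral_gauss // -EFinM /hr_const -/c1 -mulrA -mulrA.
  congr (_ * _)%:E; rewrite [RHS]mulrC; congr (_ * Num.sqrt (_ * _)).
  rewrite det_inv invrK (det_CM_complement cG p0 enum_val_inj hB) -/S CM_mxsub.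
  by rewrite mulrAC divff ?mul1r // -unitfE -unitmxE.
- exact: measurable_gauss.
- by rewrite lee_fin mulr_ge0 ?expR_ge0 // invr_ge0 sqrtr_ge0.
Qed.

End Marginal.

(** * Conditional independence through the cross block *)

Lemma card_setC_balance (T : finType) (A B C : {set T}) :
  [disjoint A & B]%bool -> [disjoint A & C]%bool -> [disjoint B & C]%bool ->
  (#|~: (A :|: B :|: C)| + #|~: C| = #|~: (A :|: C)| + #|~: (B :|: C)|)%N.
Proof.
move=> AB AC BC.
have cE (X Y : {set T}) : [disjoint X & Y]%bool ->
    #|X :|: Y| = (#|X| + #|Y|)%N.
  by rewrite -finset.setI_eq0 -cardsUI => /eqP ->; rewrite cards0 addn0.
have ABC : [disjoint A :|: B & C]%bool.
  by rewrite -finset.setI_eq0 finset.setIUl finset.setU_eq0 !finset.setI_eq0 AC.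
have := cardsC (A :|: B :|: C); have := cardsC C.
have := cardsC (A :|: C); have := cardsC (B :|: C).
rewrite !cE //.
move: #|A| #|B| #|C| #|T| #|~: _| #|~: _| #|~: _| #|~: _|; clear.
lia.
Qed.

Section SetIndices.
Variable d : nat.

Definition set_idx (D : {set 'I_d}) : 'I_#|D| -> 'I_(d + 1) :=
  lshift 1 \o enum_val.

Definition border_set_idx (D : {set 'I_d}) : 'I_(#|D| + 1) -> 'I_(d + 1) :=
  border_idx (@enum_val _ (mem D)).

Lemma set_idx_inj D : injective (@set_idx D).
Proof. by move=> i j /lshift_inj /enum_val_inj. Qed.

Lemma border_set_idx_inj D : injective (@border_set_idx D).
Proof. exact/border_idx_inj/enum_val_inj. Qed.

Lemma codom_set_idx (D : {set 'I_d}) (x : 'I_d + 'I_1) :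
  (fintype.unsplit x \in codom (@set_idx D)) =
  if x is inl i then i \in D else false.
Proof.
case: x => i /=; last first.
  by apply/negP => /codomP[k] /eqP; rewrite /set_idx /= eq_rlshift.
apply/codomP/idP => [[k] /lshift_inj ->|iD]; first exact: enum_valP.
by exists (enum_rank_in iD i); rewrite /set_idx /= enum_rankK_in.
Qed.

Lemma codom_border_set_idx (D : {set 'I_d}) (x : 'I_d + 'I_1) :
  (fintype.unsplit x \in codom (@border_set_idx D)) =
  if x is inl i then i \in D else true.
Proof.
rewrite codom_join_idx (codom_set_idx D x); case: x => i /=; last first.
  by apply/codomP; exists i.
by case: (i \in D) => //=; apply/negP => /codomP[k] /eqP; rewrite eq_lrshift.
Qed.

Lemma border_set_idx_neq (D E : {set 'I_d}) (i : 'I_(#|D| + 1)) (j : 'I_#|E|) :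
  [disjoint D & E]%bool -> border_set_idx i != set_idx j.
Proof.
move=> dis; apply/eqP => e.
have := codom_f (@set_idx E) j; have := codom_f (@border_set_idx D) i.
rewrite e -(splitK (set_idx j)) codom_border_set_idx codom_set_idx.
case: (fintype.split _) => // k kD kE.
by move/pred0P: dis => /(_ k) /=; rewrite kD kE.
Qed.

(** The increasing list of the union and the block list, [C] and the border
    first, differ by a bijection of the positions. *)
Lemma border_set_idx_join (C D E : {set 'I_d}) q (g : 'I_q -> 'I_(d + 1)) :
  injective g -> codom g =i codom (@set_idx D) -> [disjoint C & D]%bool ->
  E = D :|: C ->
  exists2 s : 'I_((#|C| + 1) + q) -> 'I_(#|E| + 1),
    bijective s & join_idx (@border_set_idx C) g =1 (@border_set_idx E) \o s.
Proof.
move=> gI gD CD eE; apply: reindex_same_codom; first exact: border_set_idx_inj.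
  apply: join_idx_inj => //; first exact: border_set_idx_inj.
  move=> i j; have := codom_f g j; rewrite gD => /codomP[k ->].
  exact: border_set_idx_neq.
move=> x; rewrite (codom_join_idx (@border_set_idx C) g) gD -(splitK x).
rewrite (codom_border_set_idx E) (codom_border_set_idx C) codom_set_idx eE.
by case: (fintype.split x) => i //; rewrite inE orbC.
Qed.

Definition pair_idx (A B : {set 'I_d}) := join_idx (@set_idx A) (@set_idx B).
Arguments pair_idx A B _ : clear implicits.

Lemma pair_idx_inj (A B : {set 'I_d}) :
  [disjoint A & B]%bool -> injective (pair_idx A B).
Proof.
move=> AB; apply: join_idx_inj; try exact: set_idx_inj.
move=> i j; rewrite (inj_eq (@lshift_inj _ _)); apply/eqP => e.
move/pred0P: AB => /(_ (enum_val i)) /=; rewrite enum_valP /= e.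
by rewrite enum_valP.
Qed.

Lemma codom_pair_idx (A B : {set 'I_d}) :
  codom (pair_idx A B) =i codom (@set_idx (A :|: B)).
Proof.
move=> x; rewrite codom_join_idx -(splitK x) !codom_set_idx.
by case: (fintype.split x) => // i; rewrite inE.
Qed.

End SetIndices.
Arguments pair_idx {d} A B _.

Section Given.
Variables (R : realType) (d : nat) (G : 'M[R]_d).
Hypothesis cG : strictly_cnd G.
Variable C : {set 'I_d}.
Hypothesis C0 : C != finset.set0.
Local Notation vec n := (n.-tuple (measurableTypeR R)).
Local Notation M := (CM G).
Local Notation c := (@border_set_idx d C).
Local Notation P := (mxsub c c M).
Local Notation S := (schur M c).

Let sM : M^T = M. Proof. by case: cG => sG _ _; exact: tr_CM. Qed.

Let d0 : (0 < d)%N.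
Proof. by case/set0Pn: C0 => i _; exact: leq_ltn_trans (ltn_ord i). Qed.

Lemma det_border_set_idx_lt0 (E : {set 'I_d}) : E != finset.set0 ->
  \det (mxsub (@border_set_idx d E) (@border_set_idx d E) M) < 0.
Proof.
move=> E0; rewrite -CM_mxsub; apply: det_CM_lt0; first by rewrite card_gt0.
by apply: strictly_cnd_mxsub => //; exact: enum_val_inj.
Qed.

Let dP : \det P < 0. Proof. exact: det_border_set_idx_lt0. Qed.

Let uP : P \in unitmx. Proof. by rewrite unitmxE unitfE lt_eqF. Qed.

Section Part.
(* The list [g] of [D] is arbitrary: for [D = A :|: B] the list that has [A]
   first and then [B] is needed. *)
Variables (D E : {set 'I_d}) (q : nat) (g : 'I_q -> 'I_(d + 1)).
Hypotheses (gI : injective g) (gD : codom g =i codom (@set_idx d D)).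
Hypotheses (CD : [disjoint C & D]%bool) (eE : E = D :|: C).
Local Notation Sg := (mxsub g g S).

Let E0 : E != finset.set0.
Proof.
case/set0Pn: C0 => i iC; apply/set0Pn; exists i.
by rewrite eE inE iC orbT.
Qed.

Let det_border_set_idxE :
  \det (mxsub (@border_set_idx d E) (@border_set_idx d E) M) =
  \det P * \det Sg.
Proof.
have [s sB es] := border_set_idx_join gI gD CD eE.
rewrite -(det_mxsub_bij _ sB) -det_join // -mxsub_comp.
by congr (\det _); apply: eq_mxsub => i; rewrite es.
Qed.

Lemma det_part_gt0 : 0 < \det Sg.
Proof.
by rewrite -(nmulr_rlt0 _ dP) -det_border_set_idxE det_border_set_idx_lt0.
Qed.

Lemma marginal_part (y : vec d) :
  Defs.marginal (hr_density G) (Defs.restrict E y) =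
  (hr_const G #|~: E| (\det P * \det Sg) *
   expR (- 2^-1 * (qform M c (point1 y) +
     quad (invmx Sg) (rowsub g (resid M c (point1 y))))))%:E.
Proof.
rewrite marginal_hr // -/(border_set_idx _) det_border_set_idxE.
congr (_ * expR (_ * _))%:E.
have uS : Sg \in unitmx by rewrite unitmxE unitfE gt_eqF // det_part_gt0.
rewrite -(qform_join _ sM uP uS).
have [s sB es] := border_set_idx_join gI gD CD eE.
rewrite (qform_bij _ sB es) //.
by rewrite unitmxE unitfE lt_eqF // det_border_set_idx_lt0.
Qed.

End Part.

Variables A B : {set 'I_d}.
Hypotheses (AB : [disjoint A & B]%bool) (AC : [disjoint A & C]%bool).
Hypothesis BC : [disjoint B & C]%bool.
Local Notation a := (@set_idx d A).
Local Notation b := (@set_idx d B).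
Local Notation ab := (pair_idx A B).

Let CA : [disjoint C & A]%bool. Proof. by rewrite disjoint_sym. Qed.
Let CB : [disjoint C & B]%bool. Proof. by rewrite disjoint_sym. Qed.

Let CAB : [disjoint C & A :|: B]%bool.
Proof.
rewrite -finset.setI_eq0 finset.setIUr finset.setU_eq0 !finset.setI_eq0.
by rewrite CA CB.
Qed.

Lemma rank_iff_cross_schur0 :
  \rank (CM (set_submx (A :|: C) (B :|: C) G)) = (#|C| + 1)%N <->
  mxsub a b S = 0.
Proof.
rewrite CM_mxsub.
have [s sB es] := border_set_idx_join (@set_idx_inj _ A) (fun=> erefl) CA erefl.
have [t tB et] := border_set_idx_join (@set_idx_inj _ B) (fun=> erefl) CB erefl.
rewrite -(mxrank_mxsub_bij _ sB tB) -mxsub_comp.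
rewrite -(eq_mxsub _ _ es et) mxrank_join //; split => [|->].
  by rewrite -[RHS]addn0 => /addnI/eqP; rewrite mxrank_eq0 => /eqP.
by rewrite mxrank0 addn0.
Qed.

(** With the coordinates in [C] fixed to 1 the residual is a translate of
    (y_A, y_B), hence arbitrary; these points have a positive coordinate because
    [C] is nonempty. *)
Lemma resid_surj (w : 'cV[R]_(#|A| + #|B|)) :
  exists y : vec d, not_le0 y /\ rowsub ab (resid M c (point1 y)) = w.
Proof.
pose t := w + mxsub ab c M *m invmx P *m const_mx 1.
pose y : vec d := [tuple if [pick j | ab j == lshift 1 i] is Some j
  then t j 0 else 1 | i < d].
have yC i : i \in C -> tnth y i = 1.
  move=> iC; rewrite tnth_mktuple; case: pickP => // j /eqP e.
  have := codom_f ab j; rewrite codom_pair_idx e (codom_set_idx _ (inl i)).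
  by move/pred0P: CAB => /(_ i) /=; rewrite iC /= => ->.
exists y; split.
  by case/set0Pn: C0 => i iC; exists i; rewrite yC.
rewrite rowsub_resid.
have -> : rowsub c (point1 y) = const_mx 1.
  apply/matrixP => i j; rewrite [LHS]mxE [RHS]mxE -(splitK i) (ord1 j).
  rewrite /border_set_idx /border_idx.
  case: (fintype.split i) => k /=; rewrite ?join_idxl ?join_idxr.
    by rewrite col_mxEu !mxE yC // enum_valP.
  by rewrite col_mxEd !mxE (ord1 k) eqxx.
apply/eqP; rewrite subr_eq; apply/eqP/matrixP => j k.
rewrite (ord1 k) mxE -/t.
have := codom_f ab j; rewrite codom_pair_idx -(splitK (ab j)) codom_set_idx.
case e : (fintype.split _) => [i|//] _.
rewrite /= col_mxEu mxE tnth_mktuple.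
have ei : ab j = lshift 1 i by rewrite -(splitK (ab j)) e.
case: pickP => [j' /eqP|/(_ j)]; last by rewrite ei eqxx.
by rewrite -ei => /(pair_idx_inj AB) ->.
Qed.

(** After cancelling the terms in y_C, conditional independence says that the
    Gaussian density with covariance [mxsub ab ab S] is the product of those
    with covariances [mxsub a a S] and [mxsub b b S] at all residuals, and so
    that the covariance is block diagonal. *)
Lemma ci_iff_cross_schur0 :
  (forall y : vec d, not_le0 y ->
   (Defs.marginal (hr_density G) (Defs.restrict (A :|: B :|: C) y) *
    Defs.marginal (hr_density G) (Defs.restrict C y) =
    Defs.marginal (hr_density G) (Defs.restrict (A :|: C) y) *
    Defs.marginal (hr_density G) (Defs.restrict (B :|: C) y))%E) <->
  mxsub a b S = 0.
Proof.
set SA := mxsub a a S; set SB := mxsub b b S; set SAB := mxsub ab ab S.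
have dA : 0 < \det SA := det_part_gt0 (@set_idx_inj _ A) (fun=> erefl) CA erefl.
have dB : 0 < \det SB := det_part_gt0 (@set_idx_inj _ B) (fun=> erefl) CB erefl.
have dAB : 0 < \det SAB :=
  det_part_gt0 (pair_idx_inj AB) (codom_pair_idx A B) CAB erefl.
pose k1 := hr_const G #|~: (A :|: B :|: C)| (\det P * \det SAB) *
           hr_const G #|~: C| (\det P).
pose k2 := hr_const G #|~: (A :|: C)| (\det P * \det SA) *
           hr_const G #|~: (B :|: C)| (\det P * \det SB).
pose r y := rowsub ab (resid M c (point1 y)).
pose Sd := block_mx (invmx SA) 0 0 (invmx SB).
have k1_gt0 : 0 < k1 by rewrite mulr_gt0 ?hr_const_gt0 ?nmulr_rlt0.
have k2_gt0 : 0 < k2 by rewrite mulr_gt0 ?hr_const_gt0 ?nmulr_rlt0.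
have reduce (y : vec d) :
    (Defs.marginal (hr_density G) (Defs.restrict (A :|: B :|: C) y) *
      Defs.marginal (hr_density G) (Defs.restrict C y) =
     Defs.marginal (hr_density G) (Defs.restrict (A :|: C) y) *
      Defs.marginal (hr_density G) (Defs.restrict (B :|: C) y))%E <->
    k1 * expR (- 2^-1 * quad (invmx SAB) (r y)) =
    k2 * expR (- 2^-1 * quad Sd (r y)).
  rewrite (marginal_part (pair_idx_inj AB) (codom_pair_idx A B) CAB erefl).
  rewrite (marginal_part (@set_idx_inj _ A) (fun=> erefl) CA erefl).
  rewrite (marginal_part (@set_idx_inj _ B) (fun=> erefl) CB erefl).
  rewrite marginal_hr // -/(border_set_idx _) -!EFinM -/SA -/SB -/SAB -/(r y).
  rewrite [r y]rowsub_join quad_diag_block -rowsub_join -/(r y).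
  rewrite /k1 /k2 !mulrDr !expRD.
  set q := expR (- 2^-1 * qform _ _ _).
  have q0 : q * q != 0 by rewrite mulf_neq0 ?gt_eqF ?expR_gt0.
  move: (hr_const _ _ _) (hr_const _ _ _) (hr_const _ _ _) (hr_const _ _ _).
  move: (expR _) (expR _) (expR _) => x1 x2 x3 h1 h2 h3 h4.
  have eL : h4 * (q * x3) * (h3 * q) = h4 * h3 * x3 * (q * q) by ring.
  have eR : h2 * (q * x2) * (h1 * (q * x1)) = h2 * h1 * (x2 * x1) * (q * q).
    by ring.
  by rewrite eL eR; split => [[] /(mulIf q0)|->].
have SE : SAB = block_mx SA (mxsub a b S) (mxsub a b S)^T SB.
  by rewrite [LHS]mxsub_join trmx_mxsub tr_schur.
have uA : SA \in unitmx by rewrite unitmxE unitfE gt_eqF.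
have uB : SB \in unitmx by rewrite unitmxE unitfE gt_eqF.
split=> [H|S0 y _].
  have {}H w : k1 * expR (- 2^-1 * quad (invmx SAB) w) =
               k2 * expR (- 2^-1 * quad Sd w).
    by have [y [yL <-]] := resid_surj w; apply/reduce/H.
  (* The residual 0 separates the constants from the exponents. *)
  have k12 : k1 = k2.
    by have := H 0; rewrite /quad !mulmx0 !mxE !mulr0 expR0 !mulr1.
  have invE : invmx SAB = Sd.
    apply/eqP; rewrite -subr_eq0; apply/eqP; apply: sym_quad0 => [|w].
      rewrite raddfB /= tr_block_mx !trmx0 !trmx_inv !trmx_mxsub tr_schur //.
    have := H w; rewrite k12 => /(mulfI (lt0r_neq0 k2_gt0))/expR_inj.
    have h0 : - 2^-1 != 0 :> R by rewrite oppr_eq0 invr_eq0 pnatr_eq0.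
    move/(mulfI h0) => eQ; rewrite /quad mulmxBr mulmxBl mxE [X in _ + X]mxE.
    by apply/eqP; rewrite subr_eq0; apply/eqP.
  have : invmx (invmx SAB) = block_mx SA 0 0 SB.
    by rewrite invE invmx_diag_block ?unitmx_inv // !invmxK.
  by rewrite invmxK SE => /eq_block_mx[].
have {}SE : SAB = block_mx SA 0 0 SB by rewrite SE S0 trmx0.
apply/reduce; rewrite SE invmx_diag_block // -/Sd; congr (_ * _).
rewrite /k1 /k2 SE; apply: hr_const_mul => //; rewrite ?nmulr_rlt0 -?SE //.
  exact: card_setC_balance.
by rewrite SE det_ublock; ring.
Qed.

End Given.

Theorem theorem3p2 (R : realType) (disp : measure_display)
    (T : measurableType disp) (P : probability T R) (d : nat)
    (Gamma : 'M[R]_d) (hGamma : strictly_cnd Gamma)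
    (Y : exponent_vector P d) (hY : husler_reiss Gamma Y)
    (A B C : {set 'I_d})
    (hAB : [disjoint A & B]) (hAC : [disjoint A & C]) (hBC : [disjoint B & C])
    (hC : C != finset.set0) :
  ext_cond_indep Y A B C <->
  \rank (CM (set_submx (A :|: C) (B :|: C) Gamma)) = (#|C| + 1)%N.
Proof.
rewrite rank_iff_cross_schur0 // -(ci_iff_cross_schur0 hGamma hC hAB hAC hBC).
have eY : exponent_density Y = hr_density Gamma by apply/funext.
by rewrite /ext_cond_indep eY.
Qed.
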